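(* (i) Let $n$ be a positive integer and suppose $(x_1, y_1)$, $(x_2, y_2)$ and $(x_3, y_3)$ are three lattice points with positive integer coordinates on the hyperbola $xy = n$ with $x_1 < x_2 < x_3$. Then $$\max(x_3 - x_1,\, y_1 - y_3) > 2^{2/3} n^{1/6} + 0.5.$$ (ii) Moreover, there exist infinitely many positive integers $n$ such that the hyperbola $xy = n$ contains three lattice points $(x_1, y_1)$, $(x_2, y_2)$ and $(x_3, y_3)$ with positive integer coordinates and $x_1 < x_2 < x_3$ satisfying $$\max(x_3 - x_1,\, y_1 - y_3) < 2^{2/3} n^{1/6} + 1.2.$$ *)

(* Defs.v *)
From Stdlib Require Import Reals ZArith.

Definition positive_point_on_hyperbola (n x y : Z) : Prop :=
  (0 < x)%Z /\ (0 < y)%Z /\ (x * y = n)%Z.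

Definition three_points_on_hyperbola (n x1 y1 x2 y2 x3 y3 : Z) : Prop :=
  positive_point_on_hyperbola n x1 y1 /\
  positive_point_on_hyperbola n x2 y2 /\
  positive_point_on_hyperbola n x3 y3 /\
  (x1 < x2)%Z /\ (x2 < x3)%Z.

(* Main.v *)
Require Import Defs.
From Stdlib Require Import Reals ZArith.
From Stdlib Require Import Lia Lra.
Open Scope R_scope.

(** Let [a], [b] be the two gaps between consecutive abscissae, [c], [d] the two
    gaps between consecutive ordinates, [s = a + b] and [t = c + d], so that the
    quantity to be estimated is [D = max s t].  Twice the area of the triangle
    spanned by the three points is the integer [delta = b c - a d], and the
    equation of the hyperbola turns it into
    [n delta^2 = a b s c d t] ([area_identity]).  As the right-hand side is
    positive, [delta <> 0].

    Lower bound.  Since [4 a b <= s^2] and [4 c d <= t^2], the identity gives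
    [16 n delta^2 <= (s t)^3].  If [s <> t], integrality gives
    [s t <= D (D - 1) < (D - 1/2)^2], hence [16 n < (D - 1/2)^6], which is the
    claim.  If [s = t = D], then [delta = D (b - d)] is a nonzero multiple of
    [D], so [16 n <= D^4], which is far stronger ([gap_bound]).

    Sharpness.  Conversely, whenever [b c - a d = 1] the points
    [(a d s, b c t)], [(a b t, c d s)], [(b c s, a d t)] lie on [x y = a b c d s t]
    and have the prescribed gaps.  To lose as little as possible one wants
    [a], [b] and [c], [d] nearly equal and [s], [t] close; [s = t] is excluded,
    and [t = s + 1] would force very unequal gaps for parity reasons, so the best
    choice is [t = s + 2], with [(a, b, c, d) = (m, m + 1, m + 1, m + 2)].  Then
    [D = 2 m + 3] while [(16 n)^(1/6) = 2 m + 2 - O(1/m)], so the excess of [D]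
    tends to [1]. *)

(** * The area identity and the integral inequality *)

(** Twice the area of the triangle has one expression in the abscissae, [n a b (a + b)]
    over [x1 x2 x3], and one in the ordinates; in their product the coordinates
    disappear because [x_i y_i = n]. *)
Lemma area_identity (n x1 y1 x2 y2 x3 y3 : Z) :
  (0 < n)%Z -> (x1 * y1 = n)%Z -> (x2 * y2 = n)%Z -> (x3 * y3 = n)%Z ->
  let a := (x2 - x1)%Z in let b := (x3 - x2)%Z in
  let c := (y1 - y2)%Z in let d := (y2 - y3)%Z in
  (n * (b * c - a * d) ^ 2 = a * b * (a + b) * (c * d * (c + d)))%Z.
Proof.
intros hn h1 h2 h3 a b c d.
assert (hx : (x1 * x2 * x3 * (b * c - a * d) = n * (a * b * (a + b)))%Z).
{ replace (x1 * x2 * x3 * (b * c - a * d))%Z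
    with ((x3 - x2) * x3 * ((x1 * y1) * x2 - x1 * (x2 * y2))
          - (x2 - x1) * x1 * ((x2 * y2) * x3 - x2 * (x3 * y3)))%Z
    by (unfold a, b, c, d; ring).
  rewrite h1, h2, h3; unfold a, b; ring. }
assert (hy : (y1 * y2 * y3 * (b * c - a * d) = n * (c * d * (c + d)))%Z).
{ replace (y1 * y2 * y3 * (b * c - a * d))%Z
    with ((y1 - y2) * y1 * ((x3 * y3) * y2 - y3 * (x2 * y2))
          - (y2 - y3) * y3 * ((x2 * y2) * y1 - y2 * (x1 * y1)))%Z
    by (unfold a, b, c, d; ring).
  rewrite h1, h2, h3; unfold c, d; ring. }
apply (Z.mul_reg_l _ _ (n ^ 2)); [nia|].
transitivity ((x1 * x2 * x3 * (b * c - a * d))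
              * (y1 * y2 * y3 * (b * c - a * d)))%Z.
- replace (x1 * x2 * x3 * (b * c - a * d) * (y1 * y2 * y3 * (b * c - a * d)))%Z
    with ((x1 * y1) * (x2 * y2) * (x3 * y3) * (b * c - a * d) ^ 2)%Z by ring.
  rewrite h1, h2, h3; ring.
- rewrite hx, hy; ring.
Qed.

Lemma four_mul_le_sqr_add (a b : Z) : (4 * (a * b) <= (a + b) ^ 2)%Z.
Proof. assert (h := Z.square_nonneg (a - b)); nia. Qed.

Lemma one_le_sqr (e : Z) : e <> 0%Z -> (1 <= e ^ 2)%Z.
Proof. intros he; assert (e < 0 \/ 0 < e)%Z by lia; nia. Qed.

(** Two unequal integers [s, t] satisfy [s t <= D (D - 1)] with [D] their
    maximum; completing the square turns [D (D - 1)] into [(D - 1/2)^2 - 1/4],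
    which is where the additive constant [1/2] of the lower bound comes from. *)
Lemma mul_lt_sqr_of_neq (s t : Z) :
  (0 < s)%Z -> (0 < t)%Z -> s <> t ->
  (4 * (s * t) < (2 * Z.max s t - 1) ^ 2)%Z.
Proof. intros hs ht hst; destruct (Z.max_spec s t) as [[? ->]|[? ->]]; nia. Qed.

Lemma eight_sqr_lt_cube (s : Z) : (3 <= s)%Z -> (8 * s ^ 2 < (2 * s - 1) ^ 3)%Z.
Proof.
intros hs.
replace s with (s - 3 + 3)%Z by ring.
assert (hk : (0 <= s - 3)%Z) by lia.
revert hk; generalize (s - 3)%Z; intros k hk.
assert (0 <= k ^ 2 /\ 0 <= k ^ 3)%Z by (split; now apply Z.pow_nonneg).
lia.
Qed.

(** This is [16 n < (D - 1/2)^6] with denominators cleared. *)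
Lemma gap_bound (n a b c d : Z) :
  (0 < n)%Z -> (0 < a)%Z -> (0 < b)%Z -> (0 < c)%Z -> (0 < d)%Z ->
  (n * (b * c - a * d) ^ 2 = a * b * (a + b) * (c * d * (c + d)))%Z ->
  (1024 * n < (2 * Z.max (a + b) (c + d) - 1) ^ 6)%Z.
Proof.
intros hn ha hb hc hd harea.
set (delta := (b * c - a * d)%Z) in *.
assert (hdelta : delta <> 0%Z).
{ intros h0; rewrite h0 in harea.
  assert (0 < a * b * (a + b) * (c * d * (c + d)))%Z
    by (repeat apply Z.mul_pos_pos; lia).
  lia. }
assert (hamgm : (16 * (n * delta ^ 2) <= ((a + b) * (c + d)) ^ 3)%Z).
{ rewrite harea.
  replace (16 * (a * b * (a + b) * (c * d * (c + d))))%Z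
    with ((4 * (a * b)) * (4 * (c * d)) * ((a + b) * (c + d)))%Z by ring.
  replace (((a + b) * (c + d)) ^ 3)%Z
    with ((a + b) ^ 2 * (c + d) ^ 2 * ((a + b) * (c + d)))%Z by ring.
  apply Z.mul_le_mono_nonneg_r; [nia|].
  apply Z.mul_le_mono_nonneg; try nia; apply four_mul_le_sqr_add. }
destruct (Z.eq_dec (a + b) (c + d)) as [hst|hst].
- assert (hfactor : delta = ((a + b) * (b - d))%Z)
    by (unfold delta; replace c with (a + b - d)%Z by lia; ring).
  rewrite <- hst in *; rewrite Z.max_id.
  (* For [a + b = 2] all four gaps are 1 and the triangle degenerates. *)
  assert (hs : (3 <= a + b)%Z).
  { destruct (Z.eq_dec (a + b) 2) as [h2|h2]; [|lia].
    exfalso; apply hdelta; rewrite hfactor.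
    replace (b - d)%Z with 0%Z by lia; ring. }
  set (s := (a + b)%Z) in *.
  assert (hbd : (1 <= (b - d) ^ 2)%Z).
  { apply one_le_sqr; intros h0; apply hdelta; rewrite hfactor, h0; ring. }
  assert (hn4 : (16 * n <= s ^ 4)%Z).
  { apply (Z.mul_le_mono_pos_r _ _ (s ^ 2)); [nia|].
    replace (s ^ 4 * s ^ 2)%Z with ((s * s) ^ 3)%Z by ring.
    apply Z.le_trans with (16 * (n * delta ^ 2))%Z; [|exact hamgm].
    rewrite hfactor.
    replace (16 * (n * (s * (b - d)) ^ 2))%Z
      with (16 * n * s ^ 2 * (b - d) ^ 2)%Z by ring.
    assert (0 < 16 * n * s ^ 2)%Z by (apply Z.mul_pos_pos; nia).
    rewrite <- (Z.mul_1_r (16 * n * s ^ 2)) at 1.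
    apply Z.mul_le_mono_nonneg_l; lia. }
  assert (hcube : (8 * s ^ 2 < (2 * s - 1) ^ 3)%Z)
    by now apply eight_sqr_lt_cube.
  apply Z.le_lt_trans with ((8 * s ^ 2) * (8 * s ^ 2))%Z; [lia|].
  replace ((2 * s - 1) ^ 6)%Z
    with ((2 * s - 1) ^ 3 * (2 * s - 1) ^ 3)%Z by ring.
  assert (0 <= s ^ 2)%Z by (apply Z.pow_nonneg; lia).
  apply Z.mul_lt_mono_nonneg; lia.
- assert (hD := mul_lt_sqr_of_neq (a + b) (c + d) ltac:(lia) ltac:(lia) hst).
  set (D := Z.max (a + b) (c + d)) in *.
  apply Z.le_lt_trans with ((4 * ((a + b) * (c + d))) ^ 3)%Z.
  + replace ((4 * ((a + b) * (c + d))) ^ 3)%Z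
      with (64 * ((a + b) * (c + d)) ^ 3)%Z by ring.
    assert (h1 := one_le_sqr delta hdelta).
    assert (0 <= n * (delta ^ 2 - 1))%Z by (apply Z.mul_nonneg_nonneg; lia).
    lia.
  + replace ((2 * D - 1) ^ 6)%Z with (((2 * D - 1) ^ 2) ^ 3)%Z by ring.
    apply Z.pow_lt_mono_l; [lia|split; [|exact hD]].
    repeat apply Z.mul_nonneg_nonneg; lia.
Qed.

(** * Sixth roots *)

Lemma Rpower_sixth_pow (m : R) : 0 < m -> Rpower m (1 / 6) ^ 6 = m.
Proof.
intros hm.
rewrite <- Rpower_pow by apply exp_pos.
rewrite Rpower_mult.
replace (1 / 6 * INR 6) with 1 by (simpl; field).
now apply Rpower_1.
Qed.

Lemma two_thirds_mul_sixth (n : R) :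
  0 < n -> Rpower 2 (2 / 3) * Rpower n (1 / 6) = Rpower (16 * n) (1 / 6).
Proof.
intros hn.
rewrite <- Rpower_mult_distr by lra.
replace 16 with (Rpower 2 (INR 4)) by (rewrite Rpower_pow; lra).
rewrite Rpower_mult.
do 2 f_equal; simpl; field.
Qed.

Lemma sixth_root_lt (m z : R) : 0 < m -> 0 <= z -> m < z ^ 6 -> Rpower m (1 / 6) < z.
Proof.
intros hm hz h.
apply Rnot_le_lt; intros hle.
assert (h6 := pow_incr _ _ 6 (conj hz hle)).
rewrite Rpower_sixth_pow in h6; lra.
Qed.

Lemma lt_sixth_root (m z : R) : 0 < m -> z ^ 6 < m -> z < Rpower m (1 / 6).
Proof.
intros hm h.
apply Rnot_le_lt; intros hle.
assert (hpos : 0 < Rpower m (1 / 6)) by apply exp_pos.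
assert (h6 := pow_incr _ _ 6 (conj (Rlt_le _ _ hpos) hle)).
rewrite Rpower_sixth_pow in h6; lra.
Qed.

(** * Lower bound and sharpness *)

Lemma hyperbola_ordinate_lt (n x y x' y' : Z) :
  positive_point_on_hyperbola n x y -> positive_point_on_hyperbola n x' y' ->
  (x < x')%Z -> (y' < y)%Z.
Proof. intros (? & ? & ?) (? & ? & ?) ?; nia. Qed.

Lemma three_points_gap_gt (n x1 y1 x2 y2 x3 y3 : Z) :
  three_points_on_hyperbola n x1 y1 x2 y2 x3 y3 ->
  Rmax (IZR (x3 - x1)) (IZR (y1 - y3)) >
    Rpower 2 (2 / 3) * Rpower (IZR n) (1 / 6) + 1 / 2.
Proof.
intros (p1 & p2 & p3 & h12 & h23).
assert (k12 := hyperbola_ordinate_lt _ _ _ _ _ p1 p2 h12).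
assert (k23 := hyperbola_ordinate_lt _ _ _ _ _ p2 p3 h23).
destruct p1 as (hx1 & hy1 & e1), p2 as (_ & _ & e2), p3 as (_ & _ & e3).
assert (hn : (0 < n)%Z) by nia.
assert (key := gap_bound n (x2 - x1) (x3 - x2) (y1 - y2) (y2 - y3) hn
  ltac:(lia) ltac:(lia) ltac:(lia) ltac:(lia)
  (area_identity n x1 y1 x2 y2 x3 y3 hn e1 e2 e3)).
replace (x2 - x1 + (x3 - x2))%Z with (x3 - x1)%Z in key by ring.
replace (y1 - y2 + (y2 - y3))%Z with (y1 - y3)%Z in key by ring.
replace (Rmax (IZR (x3 - x1)) (IZR (y1 - y3)))
  with (IZR (Z.max (x3 - x1) (y1 - y3))).
2: { destruct (Z.max_spec (x3 - x1) (y1 - y3)) as [[h ->]|[h ->]].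
     - apply IZR_lt in h; rewrite Rmax_right; lra.
     - apply IZR_le in h; rewrite Rmax_left; lra. }
assert (hD : (1 <= Z.max (x3 - x1) (y1 - y3))%Z) by lia.
set (D := Z.max (x3 - x1) (y1 - y3)) in *.
apply IZR_lt in key; apply IZR_le in hD.
assert (hn' : 0 < IZR n) by now apply IZR_lt.
rewrite two_thirds_mul_sixth by exact hn'.
enough (Rpower (16 * IZR n) (1 / 6) < IZR D - 1 / 2) by lra.
apply sixth_root_lt; [lra|lra|].
rewrite mult_IZR in key.
change 6%Z with (Z.of_nat 6) in key.
rewrite <- pow_IZR, minus_IZR, mult_IZR in key.
replace (2 * IZR D - 1) with (2 * (IZR D - 1 / 2)) in key by field.
rewrite Rpow_mult_distr in key; lra.
Qed.

(** The gaps here are [m, m + 1] for the abscissae and [m + 1, m + 2] for the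
    ordinates, so that [b c - a d = (m + 1)^2 - m (m + 2) = 1]. *)
Lemma close_three_points (m : Z) :
  (0 < m)%Z ->
  three_points_on_hyperbola
    (m * (m + 1) ^ 2 * (m + 2) * (2 * m + 1) * (2 * m + 3))
    (m * (m + 2) * (2 * m + 1)) ((m + 1) ^ 2 * (2 * m + 3))
    (m * (m + 1) * (2 * m + 3)) ((m + 1) * (m + 2) * (2 * m + 1))
    ((m + 1) ^ 2 * (2 * m + 1)) (m * (m + 2) * (2 * m + 3)).
Proof.
intros hm.
repeat split; try ring; try (repeat apply Z.mul_pos_pos; nia); nia.
Qed.

(** With [w = 2 m + 2] the right-hand side is [w^2 (w^2 - 1) (w^2 - 4)], which
    has no term in [w^5], whereas [(w - 1/5)^6] has a negative one. *)
Lemma close_three_points_estimate (m : R) :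
  10 <= m ->
  (2 * m + 9 / 5) ^ 6
    < 16 * (m * (m + 1) ^ 2 * (m + 2) * (2 * m + 1) * (2 * m + 3)).
Proof.
intros hm.
set (k := m - 10).
assert (hk : 0 <= k) by (unfold k; lra).
replace m with (k + 10) by (unfold k; ring).
(* After this shift all coefficients of the difference are positive. *)
assert (0 <= k ^ 2 /\ 0 <= k ^ 3 /\ 0 <= k ^ 4 /\ 0 <= k ^ 5)
  by (repeat split; now apply pow_le).
lra.
Qed.

Theorem corollary1 :
  (forall n x1 y1 x2 y2 x3 y3 : Z,
      (0 < n)%Z ->
      three_points_on_hyperbola n x1 y1 x2 y2 x3 y3 ->
      Rmax (IZR (x3 - x1)) (IZR (y1 - y3)) >
        Rpower 2 (2 / 3) * Rpower (IZR n) (1 / 6) + 1 / 2)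
  /\
  (forall N : Z, exists n : Z, (N < n)%Z /\ (0 < n)%Z /\
      exists x1 y1 x2 y2 x3 y3 : Z,
        three_points_on_hyperbola n x1 y1 x2 y2 x3 y3 /\
        Rmax (IZR (x3 - x1)) (IZR (y1 - y3)) <
          Rpower 2 (2 / 3) * Rpower (IZR n) (1 / 6) + 12 / 10).
Proof.
split.
- intros n x1 y1 x2 y2 x3 y3 _; apply three_points_gap_gt.
- intros N.
  set (m := Z.max N 10).
  assert (hm : (10 <= m)%Z) by lia.
  assert (hN : (N <= m)%Z) by lia.
  clearbody m.
  assert (hpts := close_three_points m ltac:(lia)).
  assert (hlarge : (m < m * (m + 1) ^ 2 * (m + 2) * (2 * m + 1) * (2 * m + 3))%Z).
  { replace (m * (m + 1) ^ 2 * (m + 2) * (2 * m + 1) * (2 * m + 3))%Z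
      with (m * ((m + 1) ^ 2 * (m + 2) * (2 * m + 1) * (2 * m + 3)))%Z by ring.
    assert (0 < (m + 1) ^ 2 * (m + 2) * (2 * m + 1))%Z
      by (repeat apply Z.mul_pos_pos; nia).
    nia. }
  eexists; split; [|split]; [| |do 6 eexists; split; [exact hpts|]]; [lia|lia|].
  replace ((m + 1) ^ 2 * (2 * m + 1) - m * (m + 2) * (2 * m + 1))%Z
    with (2 * m + 1)%Z by ring.
  replace ((m + 1) ^ 2 * (2 * m + 3) - m * (m + 2) * (2 * m + 3))%Z
    with (2 * m + 3)%Z by ring.
  assert (hn : 0 < IZR (m * (m + 1) ^ 2 * (m + 2) * (2 * m + 1) * (2 * m + 3)))
    by (apply IZR_lt; lia).
  rewrite Rmax_right by (apply IZR_le; lia).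
  rewrite two_thirds_mul_sixth by exact hn.
  rewrite plus_IZR, mult_IZR.
  enough (2 * IZR m + 9 / 5 <
    Rpower (16 * IZR (m * (m + 1) ^ 2 * (m + 2) * (2 * m + 1) * (2 * m + 3)))
      (1 / 6)) by lra.
  apply lt_sixth_root; [lra|].
  change ((m + 1) ^ 2)%Z with ((m + 1) ^ Z.of_nat 2)%Z.
  rewrite !mult_IZR, <- pow_IZR, !plus_IZR, !mult_IZR.
  apply close_three_points_estimate; now apply IZR_le.
Qed.
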